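(* If $G$ is a good graph of maximum degree $\Delta$, then $\chi_{mac}(G)\leq 2\Delta(\Delta-1)+1$.
   Context: All graphs are finite, simple and undirected. For a graph $G$ and a vertex $u$, $N_G(u)$ denotes the set of neighbors of $u$ and $d_G(u)=|N_G(u)|$ its degree. For a positive integer $k$, let $[k]=\{1,2,\ldots,k\}$. For $c:V(G)\to[k]$ define $s_c(u)=\sum_{v\in N_G(u)}c(v)$ for every $u\in V(G)$. The function $c$ is a majority additive $k$-coloring of $G$ if there is no vertex $u$ of $G$ and no integer $s$ such that $d_G(u)\geq 2$ and $s_c(v)=s$ for more than half of the neighbors $v$ of $u$. A graph $G$ is good if there do NOT exist a vertex $u\in V(G)$ and a set $R\subseteq N_G(u)$ such that $2|R|>d_G(u)>1$ and $N_G(v)=N_G(w)$ for all $v,w\in R$. (A graph is good if and only if it has a majority additive $k$-coloring for some positive integer $k$.) For a good graph $G$, the majority additive chromatic number $\chi_{mac}(G)$ is the smallest positive integer $k$ such that $G$ has a majority additive $k$-coloring. *)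

(* Defs.v *)
From mathcomp Require Import all_boot.
From mathcomp Require Import boolp.

Set Implicit Arguments.
Unset Strict Implicit.
Unset Printing Implicit Defensive.

Record sgraph := SGraph {
  vertex :> finType;
  adj : rel vertex;
  adj_sym : symmetric adj;
  adj_irr : irreflexive adj }.

Definition nbr (G : sgraph) (u : G) : {set G} := [set v | adj u v].

Definition deg (G : sgraph) (u : G) : nat := #|nbr u|.

(* Equal to 0 for the graph without vertices. *)
Definition max_degree (G : sgraph) : nat := \max_(u : G) deg u.

Definition nbr_sum (G : sgraph) (c : G -> nat) (u : G) : nat :=
  \sum_(v in nbr u) c v.

(* The values of nbr_sum are naturals, so no other integer s can be the common
   value of a nonempty set of neighbours. *)
Definition majority_additive (G : sgraph) (c : G -> nat) : Prop :=
  ~ exists (u : G) (s : nat),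
      2 <= deg u /\ deg u < 2 * #|[set v in nbr u | nbr_sum c v == s]|.

(* A map to [k] = {1, ..., k} is a nat-valued map with values in that range. *)
Definition mac_coloring (G : sgraph) (k : nat) (c : G -> nat) : Prop :=
  (forall v, 1 <= c v <= k) /\ majority_additive c.

Definition mac_colorable (G : sgraph) (k : nat) : Prop :=
  exists c : G -> nat, mac_coloring k c.

Definition good (G : sgraph) : Prop :=
  ~ exists (u : G) (R : {set G}),
      [/\ R \subset nbr u, deg u < 2 * #|R|, 1 < deg u &
          {in R &, forall v w, nbr v = nbr w}].

Lemma binary_inj n (b b' : nat -> bool) :
  \sum_(i < n) b i * 2 ^ i = \sum_(i < n) b' i * 2 ^ i ->
  forall i, i < n -> b i = b' i.
Proof.
elim: n b b' => [|n IHn] b b' //.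
have E (f : nat -> bool) :
    \sum_(i < n.+1) f i * 2 ^ i = f 0 + (\sum_(i < n) f i.+1 * 2 ^ i).*2.
  rewrite big_ord_recl /= expn0 muln1 -muln2 big_distrl /=; congr (_ + _).
  by apply: eq_bigr => i _; rewrite -mulnA -expnSr.
rewrite !E => eq_s.
have b0 : b 0 = b' 0.
  by move/(congr1 odd): eq_s; rewrite !oddD !odd_double !addbF !oddb.
case=> [|i] // lt_i.
apply: (IHn (fun i => b i.+1) (fun i => b' i.+1)) => //.
by move: eq_s; rewrite b0 => /addnI /double_inj.
Qed.

Lemma sum_pow2_inj (T : finType) (A B : {set T}) :
  \sum_(v in A) 2 ^ enum_rank v = \sum_(v in B) 2 ^ enum_rank v -> A = B.
Proof.
pose b (A : {set T}) (i : nat) := [exists v in A, enum_rank v == i :> nat].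
have bE (C : {set T}) v : b C (enum_rank v) = (v \in C).
  apply/exists_inP/idP => [[w wC /eqP/val_inj/enum_rank_inj <-] //|vC].
  by exists v.
have E (C : {set T}) :
    \sum_(v in C) 2 ^ enum_rank v = \sum_(i < #|T|) b C i * 2 ^ i.
  rewrite (reindex (@enum_rank T)) /=; last first.
    by apply: onW_bij; apply: enum_rank_bij.
  by rewrite big_mkcond; apply: eq_bigr => v _; rewrite bE; case: ifP;
    rewrite ?mul1n ?mul0n.
rewrite !E => /binary_inj eq_b; apply/setP=> v.
by rewrite -!bE; apply: eq_b.
Qed.

Lemma good_mac_colorable (G : sgraph) :
  good G -> exists k, `[< 0 < k /\ mac_colorable G k >].
Proof.
move=> gG; exists (2 ^ #|G|); apply/asboolP; split; first by rewrite expn_gt0.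
exists (fun v => 2 ^ enum_rank v); split=> [v|[u [s [deg2 maj]]]].
  by rewrite expn_gt0 leq_exp2l //= ltnW.
apply: gG; exists u.
exists [set v in nbr u | nbr_sum (fun v : G => 2 ^ enum_rank v) v == s].
split=> //; first by apply/subsetP=> v; rewrite inE => /andP[].
move=> v w; rewrite !inE => /andP[_ /eqP sv] /andP[_ /eqP sw].
by apply: sum_pow2_inj; apply: etrans sv _.
Qed.

Definition chi_mac (G : sgraph) (gG : good G) : nat :=
  ex_minn (good_mac_colorable gG).

Lemma chi_macP (G : sgraph) (gG : good G) :
  [/\ 0 < chi_mac gG, mac_colorable G (chi_mac gG) &
      forall k, 0 < k -> mac_colorable G k -> chi_mac gG <= k].
Proof.
rewrite /chi_mac; case: ex_minnP => m /asboolP[m0 mc] min_m; split=> // k k0 kc.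
by apply: min_m; apply/asboolP.
Qed.

(* Main.v *)
Require Import Defs.
From mathcomp Require Import all_boot.
From mathcomp Require Import perm zify.

(** For every vertex [u] of degree at least 2, goodness bounds the number of
    neighbours of [u] sharing a given neighbourhood by [deg u / 2], hence some
    permutation [p u] of [nbr u] changes the neighbourhood of every vertex it
    moves.  If a colouring gives [v] and [p u v] different sums for all [u] and
    all [v] in [nbr u], then a monochromatic (for the sums) subset [R] of
    [nbr u] is disjoint from [p u @: R], so it is not a majority.  Such a
    colouring is found greedily: the constraint [(u, v)] restricts the colour of
    [x] only if [x] lies in exactly one of the neighbourhoods of [v] and
    [p u v], in which case it forbids a single value.  Then [x] is adjacent to
    one of these two vertices, say [w], and [u] is a neighbour of [w] other than
    [x]; so at most [2 * Delta * (Delta - 1)] values are forbidden. *)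

(** Among the permutations supported on [S], take one with the fewest points kept in their fiber;
    any such point would allow a transposition that lowers this number. *)
Lemma perm_avoid_fibers (T : finType) (K : eqType) (f : T -> K) (S : {set T}) :
  (forall v, v \in S -> 2 * #|[set w in S | f w == f v]| <= #|S|) ->
  exists2 p : {perm T}, perm_on S p & forall v, v \in S -> f (p v) != f v.
Proof.
move=> small.
pose bad (p : {perm T}) := [set v in S | f (p v) == f v].
case: (@arg_minnP _ (1%g : {perm T}) (fun p => perm_on S p) (fun p => #|bad p|)).
  exact: perm_on1.
move=> p pS min_p; exists p => // v vS; apply/negP => /eqP fpv.
(* Otherwise swap the images of [v] and of some [w] for which neither [w] nor
   [p w] is in the fiber of [v]; this makes [p] correct at both points. *)
pose F := [set w in S | f w == f v].
pose F' := [set w in S | f (p w) == f v].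
have cardF' : #|F'| <= #|F|.
  rewrite -(card_imset F' (@perm_inj _ p)); apply: subset_leq_card; apply/subsetP=> y.
  by case/imsetP=> w; rewrite inE => /andP[wS fw] ->; rewrite inE fw perm_closed ?wS.
have cardI : 0 < #|F :&: F'|.
  by rewrite card_gt0; apply/set0Pn; exists v; rewrite !inE vS fpv eqxx.
have FS : F :|: F' \subset S.
  by apply/subsetP=> w; rewrite !inE => /orP[] /andP[].
(* Both sets have at most [#|S| / 2] elements and they share [v], so their union misses a point of
   [S]. *)
have /properP[_ [w wS]] : F :|: F' \proper S.
  rewrite properEcard FS cardsU.
  have := subset_leq_card (subsetIl F F').
  by have := small v vS; rewrite -/F /=; lia.
rewrite !inE wS /= negb_or => /andP[fw fpw].
pose q : {perm T} := (tperm v w * p)%g.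
have qS : perm_on S q.
  apply: perm_onM => //; apply/subsetP=> z; rewrite inE.
  by case: tpermP => [-> //|-> //|_ _]; rewrite eqxx.
have /min_p : perm_on S q by [].
rewrite leqNgt => /negP; apply; apply: proper_card; apply/properP; split.
  apply/subsetP=> z; rewrite !inE permM => /andP[zS].
  case: tpermP => [->|->|_ _ fz]; last by rewrite zS.
    by rewrite (negPf fpw).
  by rewrite fpv eq_sym (negPf fw).
exists v; first by rewrite inE vS fpv eqxx.
by rewrite inE permM tpermL (negPf fpw) andbF.
Qed.

Lemma exists_color_notin (I : finType) (J : {set I}) (t : I -> nat) (m : nat) :
  #|J| <= m -> exists2 k, 1 <= k <= m.+1 & forall i, i \in J -> t i != k.
Proof.
move=> leJ.
have /existsP[k kP] : [exists k : 'I_m.+1, k.+1 \notin [seq t i | i in J]].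
  apply: contraT; rewrite negb_exists => /forallP all_t.
  have : size (iota 1 m.+1) <= size [seq t i | i in J].
    apply: uniq_leq_size; first exact: iota_uniq.
    move=> k; rewrite mem_iota => /andP[k1 km].
    have km' : k.-1 < m.+1 by lia.
    by have := all_t (Ordinal km'); rewrite negbK /= prednK.
  by rewrite size_iota size_image; lia.
exists k.+1; first by rewrite ltn_ord.
by move=> i iJ; apply: contra kP => /eqP <-; apply: image_f.
Qed.

(** Recolouring [x] affects the difference of the two sums only for constraints with [x] in exactly
    one set. Each of these excludes one value, so [m + 1] values leave a choice. *)
Lemma greedy_coloring (T I : finType) (C : {set I}) (A B : I -> {set T}) (m : nat) :
  (forall i, i \in C -> A i != B i) ->
  (forall x, #|[set i in C | (x \in A i) (+) (x \in B i)]| <= m) ->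
  exists c : T -> nat, (forall x, 1 <= c x <= m.+1) /\
    forall i, i \in C -> \sum_(x in A i) c x != \sum_(x in B i) c x.
Proof.
move=> AB few.
(* Invariant: the constraints whose symmetric difference lies in the processed list hold. For the
   empty list there are none, as [A i != B i]. *)
suff [c [c_range cP]] : exists c : T -> nat, (forall x, 1 <= c x <= m.+1) /\
    forall i, i \in C -> (forall x, (x \in A i) (+) (x \in B i) -> x \in enum T) ->
      \sum_(x in A i) c x != \sum_(x in B i) c x.
  by exists c; split=> // i iC; apply: cP => // x _; rewrite mem_enum.
elim: (enum T) => [|x s [c [c_range cP]]].
  exists (fun=> 1); split=> // i iC sub; case/negP: (AB i iC).
  by apply/eqP/setP => x; have := sub x; case: (x \in A i) (x \in B i) => [] [] // /(_ isT).
pose sA i := \sum_(y in A i | y != x) c y; pose sB i := \sum_(y in B i | y != x) c y.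
(* Subtraction is truncated, so the forbidden value is the absolute difference of [sA i] and [sB i];
   it covers both cases, [x] in [A i] only and [x] in [B i] only. *)
have [k k_range kP] :=
  @exists_color_notin _ _ (fun i => (sA i - sB i) + (sB i - sA i)) m (few x).
pose c' y := if y == x then k else c y.
have sumE (D : {set T}) (a : nat) :
    \sum_(y in D) (if y == x then a else c y)
    = (x \in D) * a + \sum_(y in D | y != x) c y.
  rewrite (bigID (pred1 x)) /=; congr (_ + _); last first.
    by apply: eq_bigr => y /andP[_ /negPf ->].
  have [xD|xD] := boolP (x \in D).
    rewrite (big_pred1 x) ?eqxx ?mul1n // => y.
    by rewrite /= andbC; case: eqP => // ->.
  by rewrite big1 // => y /andP[yD /eqP yx]; rewrite -yx yD in xD.
have cE (D : {set T}) :
    \sum_(y in D) c y = (x \in D) * c x + \sum_(y in D | y != x) c y.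
  by rewrite -sumE; apply: eq_bigr => y _; case: eqP => [->|].
exists c'; split=> [y|i iC sub]; first by rewrite /c'; case: ifP.
rewrite !sumE -/(sA i) -/(sB i).
have [x_one|x_both] := boolP ((x \in A i) (+) (x \in B i)).
  have := kP i; rewrite inE iC x_one => /(_ isT).
  by case: (x \in A i) (x \in B i) x_one => [] [] //= _; lia.
(* Here [x] contributes equally to both sums, so the inequality for the old colouring [c] carries
   over. *)
have := cP i iC; rewrite !cE -/(sA i) -/(sB i).
have sub_s y : (y \in A i) (+) (y \in B i) -> y \in s.
  move=> y_one; have := sub y y_one; rewrite inE => /orP[/eqP yx|//].
  by rewrite -yx y_one in x_both.
move=> /(_ sub_s).
by case: (x \in A i) (x \in B i) x_both => [] [] //= _; lia.
Qed.

Lemma leq_deg_max (G : sgraph) (u : G) : deg u <= max_degree G.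
Proof. exact: (@leq_bigmax _ (@deg G) u). Qed.

Lemma good_small_twins (G : sgraph) (gG : good G) (u v : G) :
  1 < deg u -> 2 * #|[set w in nbr u | nbr w == nbr v]| <= deg u.
Proof.
move=> deg2; rewrite leqNgt; apply/negP => big; apply: gG.
exists u, [set w in nbr u | nbr w == nbr v]; split=> //.
  by apply/subsetP=> w; rewrite inE => /andP[].
by move=> w w'; rewrite !inE => /andP[_ /eqP ->] /andP[_ /eqP ->].
Qed.

Lemma good_perm (G : sgraph) (gG : good G) (u : G) :
  exists p : {perm G}, perm_on (nbr u) p /\
    (1 < deg u -> forall v, v \in nbr u -> nbr (p v) != nbr v).
Proof.
have [deg2|_] := boolP (1 < deg u); last by exists 1%g; split=> //; apply: perm_on1.
have [p pu pP] := @perm_avoid_fibers _ _ (@nbr G) (nbr u)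
  (fun v _ => good_small_twins _ gG u v deg2).
by exists p.
Qed.

(** A pair [e] encodes the walk [x, e.2, e.1], in the order of the constraints [(u, v)]. The middle
    vertex has at most [max_degree G] choices; the end, which avoids [x], has one fewer. *)
Lemma card_walk2 (G : sgraph) (x : G) :
  #|[set e : G * G | [&& e.2 \in nbr x, e.1 \in nbr e.2 & e.1 != x]]|
    <= max_degree G * (max_degree G - 1).
Proof.
rewrite -sum1_card.
rewrite (eq_bigl (fun e : G * G => (e.2 \in nbr x) && (e.1 \in nbr e.2 :\ x))); last first.
  by move=> e; rewrite !inE [X in _ && X]andbC.
rewrite (reindex (fun e : G * G => (e.2, e.1))) /=; last first.
  by exists (fun e : G * G => (e.2, e.1)) => [] [].
rewrite -(pair_big_dep (fun v => v \in nbr x) (fun v w => w \in nbr v :\ x)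
  (fun _ _ => 1)) /=.
apply: (@leq_trans (\sum_(v in nbr x) (max_degree G - 1))).
  apply: leq_sum => v vx; rewrite sum1_card.
  have xv : x \in nbr v by rewrite inE adj_sym; rewrite inE in vx.
  have := cardsD1 x (nbr v); rewrite xv.
  by have := leq_deg_max G v; rewrite /deg; lia.
by rewrite sum_nat_const leq_mul2r leq_deg_max orbT.
Qed.

Theorem theorem2 (G : sgraph) (gG : good G) :
  chi_mac gG <= 2 * max_degree G * (max_degree G - 1) + 1.
Proof.
have [_ _ chi_min] := chi_macP gG; apply: chi_min; first by lia.
have [p pP] := fin_all_exists (good_perm _ gG).
have p_on u : perm_on (nbr u) (p u) by case: (pP u).
pose C := [set e : G * G | (1 < deg e.1) && (e.2 \in nbr e.1)].
pose A (e : G * G) := nbr e.2; pose B (e : G * G) := nbr (p e.1 e.2).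
have AB e : e \in C -> A e != B e.
  by rewrite inE => /andP[deg2 eu]; rewrite eq_sym; case: (pP e.1) => _; apply.
have few x : #|[set e in C | (x \in A e) (+) (x \in B e)]|
    <= 2 * max_degree G * (max_degree G - 1).
  pose W := [set e : G * G | [&& e.2 \in nbr x, e.1 \in nbr e.2 & e.1 != x]].
  pose h (e : G * G) := (e.1, p e.1 e.2).
  have h_inj : injective h.
    by case=> u v [u' v'] [<-] /perm_inj <-.
  have sub : [set e in C | (x \in A e) (+) (x \in B e)] \subset W :|: h @^-1: W.
    apply/subsetP=> -[u v]; rewrite inE => /andP[]; rewrite inE /= => /andP[_ vu].
    have pvu : p u v \in nbr u by rewrite perm_closed.
    move: vu pvu; rewrite /A /B !inE /=.
    (* If [u = x], then [x] is adjacent to both [v] and [p u v], so the constraint does not restrict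
       [x]. *)
    move=> uv upv; have [<-|_] := eqVneq u x.
      by rewrite ![adj _ u]adj_sym uv upv.
    rewrite [adj v u]adj_sym [adj (p u v) u]adj_sym uv upv !andbT.
    by rewrite ![adj x _]adj_sym; do 2!case: adj.
  apply: leq_trans (subset_leq_card sub) _.
  apply: leq_trans (leq_card_setU _ _) _.
  have := card_walk2 G x; rewrite -/W => leW.
  have : #|h @^-1: W| <= #|W|.
    rewrite -(card_imset _ h_inj); apply: subset_leq_card; apply/subsetP=> y.
    by case/imsetP=> e; rewrite inE => eW ->.
  by rewrite -mulnA; lia.
have [c [c_range cP]] := greedy_coloring _ _ C A B _ AB few.
exists c; split=> [v|[u [s [deg2]]]]; first by rewrite addn1.
set R := [set v in nbr u | _]; rewrite ltnNge => /negP; apply.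
have RS : R \subset nbr u by apply/subsetP=> v; rewrite inE => /andP[].
have pRS : p u @: R \subset nbr u.
  by apply/subsetP=> y /imsetP[v vR ->]; rewrite perm_closed // (subsetP RS).
have dis : R :&: p u @: R = set0.
  apply/eqP; rewrite -subset0; apply/subsetP=> w; rewrite inE => /andP[wR].
  case/imsetP=> v vR wE; move: wR vR; rewrite !inE wE.
  move=> /andP[_ /eqP pvs] /andP[uv /eqP vs].
  have := cP (u, v); rewrite !inE deg2 uv => /(_ isT).
  by rewrite -[X in X != _]/(nbr_sum c v) -[X in _ != X]/(nbr_sum c (p u v)) pvs vs eqxx.
have := subset_leq_card (_ : R :|: p u @: R \subset nbr u).
rewrite cardsU dis cards0 (card_imset _ (@perm_inj _ (p u))) subUset RS pRS.
by rewrite /deg => /(_ isT); lia.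
Qed.
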